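(* For every integer $d>0$, $\mathbb{A}_{\leq d}\not\leq_{BSS}\mathbb{A}_{\leq d-1}$. In particular, $\mathbb{A}_{=d}\not\leq_{BSS}\mathbb{A}_{\leq d-1}$.
   Context: BSS machines (Blum–Shub–Smale model over $\mathbb{R}$): $\mathbb{R}^\infty$ denotes the set of finite tuples of reals. A BSS machine has a program with finitely many real constants (parameters); it can apply the field operations $+,-,\times,\div$ to cell contents, copy cells, overwrite a cell with $0$, and branch according to whether a cell's content is $=0$, $<0$ or $>0$. An oracle BSS machine with oracle $B\subseteq\mathbb{R}^\infty$ may additionally branch on whether a previously computed tuple lies in $B$. For $A,B\subseteq\mathbb{R}^\infty$, $B\leq_{BSS}A$ means the characteristic function of $B$ is computed by some oracle BSS machine (with real parameters allowed) using oracle $A$. $\mathbb{A}$ is the set of real numbers algebraic over $\mathbb{Q}$; $\mathbb{A}_{=d}$ is the set of real algebraic numbers of degree exactly $d$ over $\mathbb{Q}$ (so $\mathbb{A}_{=0}=\emptyset$, $\mathbb{A}_{=1}=\mathbb{Q}$), and $\mathbb{A}_{\leq d}=\bigcup_{c\leq d}\mathbb{A}_{=c}$. *)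

(* Defs.v *)
From mathcomp Require Import all_boot all_order all_algebra.
From mathcomp Require Import boolp classical_sets reals numfun.

Set Implicit Arguments.
Unset Strict Implicit.
Unset Printing Implicit Defensive.

Import Order.TTheory GRing.Theory Num.Theory.

Local Open Scope classical_set_scope.
Local Open Scope ring_scope.

(** * Oracle BSS machines over [R]

    The set of finite tuples of reals is [seq R].  The memory is an infinite
    sequence of real cells.  As in the original model of Blum, Shub and Smale,
    whose state space is Z+ x Z+ x R^oo, a machine also has natural-number index
    registers: they are what lets one finite program address the cells of inputs
    of unbounded length. *)

(* [Dir k] is the cell of address [k]; [Ind r] is the cell whose address is the
   current content of index register [r]. *)
Inductive loc : Type := Dir of nat | Ind of nat.

Inductive arith : Type := Add | Sub | Mul | Div.

(* [k] is the destination, [i] and [j] are sources, and [lneg], [lyes], ... are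
   program addresses.  The real parameters of a machine are the constants
   occurring in its [Const] instructions. *)
Inductive instr (R : Type) : Type :=
| Const (k : loc) (c : R)
| Arith (op : arith) (k i j : loc)
| Copy (k i : loc)
| Zero (k : loc)
| Branch (i : loc) (lneg lzero lpos : nat)
| IdxIncr (r : nat)
| IdxDecr (r : nat)
| IdxBranch (r : nat) (lzero lpos : nat)
  (* is the tuple of cells [a], ..., [a + n - 1] in the oracle set, where [a]
     and [n] are the contents of index registers [p] and [q]? *)
| Query (p q : nat) (lyes lno : nat)
| Halt.

Arguments Arith {R}.
Arguments Copy {R}.
Arguments Zero {R}.
Arguments Branch {R}.
Arguments IdxIncr {R}.
Arguments IdxDecr {R}.
Arguments IdxBranch {R}.
Arguments Query {R}.
Arguments Halt {R}.

Definition program (R : Type) : Type := seq (instr R).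

Record config (R : Type) : Type := Config {
  pc : nat;
  idx : nat -> nat;
  cells : nat -> R
}.

Definition addr (R : Type) (s : config R) (l : loc) : nat :=
  match l with Dir k => k | Ind r => idx s r end.

Definition get (R : Type) (s : config R) (l : loc) : R := cells s (addr s l).

Definition put (R : Type) (s : config R) (l : loc) (v : R) : config R :=
  Config (pc s).+1 (idx s) [eta cells s with addr s l |-> v].

Definition put_idx (R : Type) (s : config R) (r n : nat) : config R :=
  Config (pc s).+1 [eta idx s with r |-> n] (cells s).

Definition jump (R : Type) (s : config R) (l : nat) : config R :=
  Config l (idx s) (cells s).

Definition block (R : Type) (s : config R) (a n : nat) : seq R :=
  [seq cells s k | k <- iota a n].

(* Division by zero is undefined. *)
Definition arith_eval (R : realType) (op : arith) (x y : R) : option R :=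
  match op with
  | Add => Some (x + y)
  | Sub => Some (x - y)
  | Mul => Some (x * y)
  | Div => if y == 0 then None else Some (x / y)
  end.

(* [None] when there is no next configuration: on [Halt], on a division by
   zero, or when the program counter points outside of the program.  Only the
   first case counts as halting, see [computes]. *)
Definition step (R : realType) (M : program R) (A : set (seq R))
    (s : config R) : option (config R) :=
  match onth M (pc s) with
  | None => None
  | Some (Const k c) => Some (put s k c)
  | Some (Arith op k i j) =>
      omap (put s k) (arith_eval op (get s i) (get s j))
  | Some (Copy k i) => Some (put s k (get s i))
  | Some (Zero k) => Some (put s k 0)
  | Some (Branch i lneg lzero lpos) =>
      Some (jump s (if get s i < 0 then lneg
                    else if get s i == 0 then lzero else lpos))
  | Some (IdxIncr r) => Some (put_idx s r (idx s r).+1)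
  | Some (IdxDecr r) => Some (put_idx s r (idx s r).-1)
  | Some (IdxBranch r lzero lpos) =>
      Some (jump s (if idx s r == 0%N then lzero else lpos))
  | Some (Query p q lyes lno) =>
      Some (jump s (if block s (idx s p) (idx s q) \in A then lyes else lno))
  | Some Halt => None
  end.

(* The input [x] occupies the cells from address 0 on and its length is in index
   register 0; all other cells and registers contain 0. *)
Definition init (R : realType) (x : seq R) : config R :=
  Config 0 [eta (fun=> 0%N) with 0%N |-> size x] (nth 0 x).

(* Outputs are read with the same convention. *)
Definition output (R : Type) (s : config R) : seq R := block s 0 (idx s 0).

Definition run (R : realType) (M : program R) (A : set (seq R)) (x : seq R)
    (t : nat) : option (config R) :=
  iter t (obind (step M A)) (Some (init x)).

Definition computes (R : realType) (M : program R) (A : set (seq R))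
    (f : seq R -> seq R) : Prop :=
  forall x : seq R, exists (t : nat) (s : config R),
    [/\ run M A x t = Some s, onth M (pc s) = Some Halt & output s = f x].

Definition bss_reducible (R : realType) (B A : set (seq R)) : Prop :=
  exists M : program R, computes M A (fun x => [:: \1_B x]).

(** * Real algebraic numbers by degree *)

Definition is_min_poly (R : realType) (x : R) (p : {poly rat}) : Prop :=
  [/\ p \is monic, root (map_poly ratr p) x &
      forall q : {poly rat}, q != 0 -> root (map_poly ratr q) x ->
        (size p <= size q)%N].

(* [size p] is one more than the degree of [p]. *)
Definition alg_eq (R : realType) (d : nat) : set R :=
  [set x | exists2 p : {poly rat}, is_min_poly x p & size p = d.+1].
Arguments alg_eq : clear implicits.

Definition alg_le (R : realType) (d : nat) : set R :=
  \bigcup_(c in [set c : nat | (c <= d)%N]) alg_eq R c.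
Arguments alg_le : clear implicits.

(* A set of reals, seen as a set of tuples of length one. *)
Definition tuples1 (R : realType) (S : set R) : set (seq R) :=
  [set [:: x] | x in S].

(* Main.v *)
From HB Require Import structures.
Require Import Defs.
From mathcomp Require Import all_boot all_order all_algebra.
From mathcomp Require Import boolp classical_sets reals numfun.
From mathcomp Require Import all_field polyrcf ring lra zify.

(** A machine run on an input [y] that is transcendental over its parameters
    only computes values [f(y)] with [f] a rational function.  By continuity an
    input [x] close to [y] follows the same path, provided that no nonconstant
    [f] whose value is sent to the oracle has [f(x)] of degree less than [d].
    The run on [x] then rejects like the run on [y], so it remains to find such
    an [x] of degree exactly [d].

    Fix [a] of degree [d] and take [x = q + r a] with [q], [r] rational.  If [f]
    is not a ratio of polynomials with algebraic coefficients, then [f] maps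
    only finitely many algebraic numbers to algebraic numbers, by linear algebra
    on the system [P(x_i) = f(x_i) Q(x_i)].  Otherwise choose automorphisms
    [nu_i] of the algebraic numbers mapping [a] to its [d] conjugates [a_i].
    The conjugates [nu_i(f(x)) = f^nu_i(q + r a_i)] are pairwise distinct, so
    that [f(x)] has degree at least [d], unless [q] is a root of a discrepancy
    between [f^nu_i(X + r a_i)] and [f^nu_j(X + r a_j)].  For given [i] and [j]
    this discrepancy vanishes identically for at most one [r]: two such values
    of [r] would make [f^nu_i] periodic, hence constant. *)

Set Implicit Arguments.
Unset Strict Implicit.
Unset Printing Implicit Defensive.

Import Order.TTheory GRing.Theory Num.Theory.

Local Open Scope ring_scope.

Local Notation pQto := (map_poly ratr).

(** * Cofinitely many rationals *)

(** A duplicate-free list of elements of [F] of the greatest possible length already contains all of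
    them, since otherwise it could be extended. *)
Lemma finite_of_bounded (T : eqType) (F : T -> Prop) (n : nat) :
    (forall s, uniq s -> (forall t, t \in s -> F t) -> (size s < n)%N) ->
  exists s : seq T, forall t, F t -> t \in s.
Proof.
elim: n => [|n IHn] bound; first by suff: (@size T [::] < 0)%N by [];
  apply: bound.
have [[s [us Fs sz_s]]|no_s] :=
  pselect (exists s, [/\ uniq s, forall t, t \in s -> F t & size s = n]).
  exists s => t Ft; apply: contraT => s't.
  have := bound (t :: s); rewrite /= s't us sz_s ltnn; apply=> //.
  by move=> u; rewrite inE => /predU1P[->|/Fs].
apply: IHn => s us Fs; have := bound s us Fs; rewrite ltnS leq_eqVlt.
by case/predU1P=> // sz_s; case: no_s; exists s.
Qed.

Lemma roots_finite (L : idomainType) (T : eqType) (f : T -> L) (p : {poly L}) :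
    injective f -> p != 0 ->
  exists s : seq T, forall t, root p (f t) -> t \in s.
Proof.
move=> f_inj nz_p; apply: (@finite_of_bounded _ _ (size p)) => s us ps.
rewrite -(size_map f); apply: max_poly_roots; rewrite ?map_inj_uniq //.
by apply/allP=> _ /mapP[t /ps pt ->].
Qed.

(** Cofiniteness is stable under finite conjunctions. Nested as [almost_all] in [r], then in [q], it
    expresses genericity of a pair of rationals. *)
Definition almost_all (F : rat -> Prop) : Prop :=
  exists s : seq rat, forall r, r \notin s -> F r.

Lemma almost_all_seq (I : eqType) (s : seq I) (F : I -> rat -> Prop) :
    (forall i, i \in s -> almost_all (F i)) ->
  almost_all (fun r => forall i, i \in s -> F i r).
Proof.
elim: s => [|i s IHs] sF; first by exists [::].
have [t1 Ft1] := sF i (mem_head _ _).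
have [|t2 Ft2] := IHs _; first by move=> j sj; apply: sF; rewrite inE sj orbT.
exists (t1 ++ t2) => r; rewrite mem_cat negb_or => /andP[t1r t2r] j.
by rewrite inE => /predU1P[->|]; [apply: Ft1 | apply: Ft2].
Qed.

Lemma almost_allS (F G : rat -> Prop) :
  (forall r, F r -> G r) -> almost_all F -> almost_all G.
Proof. by move=> sFG [s Fs]; exists s => r /Fs/sFG. Qed.

Lemma almost_allI (F G : rat -> Prop) :
  almost_all F -> almost_all G -> almost_all (fun r => F r /\ G r).
Proof.
move=> [s Fs] [t Gt]; exists (s ++ t) => r; rewrite mem_cat negb_or.
by case/andP=> /Fs ? /Gt.
Qed.

(** Exceptional rationals are removed one by one: whenever one exceeds [a], the right end is lowered
    to it if necessary. Density of the rationals then applies. *)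
Lemma almost_all_itv (R : realType) (F : rat -> Prop) (a b : R) :
  almost_all F -> a < b -> exists2 r, F r & a < ratr r < b.
Proof.
case=> s; elim: s F a b => [|t s IHs] F a b sF ab.
  by have [q] := rat_in_itvoo ab; rewrite in_itv /= => abq; exists q;
    first exact: sF.
have [b' ab' [b'b nt]] : exists2 b' : R, a < b' &
    b' <= b /\ forall x, a < x < b' -> x != ratr t.
  have [tb|bt] := ltP a (ratr t); last first.
    exists b => //; split=> // x /andP[ax _].
    by rewrite gt_eqF // (le_lt_trans bt).
  exists (Num.min b (ratr t)); first by rewrite lt_min ab.
  by rewrite ge_min lexx; split=> // x; rewrite lt_min => /and3P[_ _ /lt_eqF->].
have [|r Fr /andP[ar rb']] := IHs (fun r => r != t -> F r) a b' _ ab'.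
  by move=> r s'r rt; apply: sF; rewrite inE negb_or rt.
exists r; last by rewrite ar (lt_le_trans rb').
by apply: Fr; apply: contra_neq (nt (ratr r) _) => [->|]; rewrite ?ar.
Qed.

(** * Constant and periodic rational functions *)

Definition constant_ratio (L : nzRingType) (P Q : {poly L}) : Prop :=
  exists c : L, P = c *: Q.

(** The condition on 2x2 minors names no constant [c], so it can be transported along field
    morphisms in both directions. *)
Lemma constant_ratioP (L : fieldType) (P Q : {poly L}) : Q != 0 ->
  constant_ratio P Q <-> forall i j, P`_i * Q`_j = P`_j * Q`_i.
Proof.
move=> nzQ; split=> [[c ->] i j|PQ].
  by rewrite !coefZ -!mulrA [Q`_i * _]mulrC.
exists (P`_(size Q).-1 / lead_coef Q); apply/polyP=> i; rewrite coefZ.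
by rewrite mulrAC -PQ mulfK ?lead_coef_eq0.
Qed.

(** A period [c] of [P / Q] yields the periods [c *+ n], which are distinct in characteristic 0.
    With [a] not a zero of [Q], the polynomial [P - (P.[a] / Q.[a]) *: Q] vanishes at every
    [a + c *+ n], hence is 0. *)
Lemma ratio_shift_constant (L : fieldType) (P Q : {poly L}) (c : L) :
    [pchar L] =i pred0 -> Q != 0 -> c != 0 ->
    (P \Po ('X + c%:P)) * Q = P * (Q \Po ('X + c%:P)) ->
  constant_ratio P Q.
Proof.
move=> L0 nzQ nzc PQ; have nzQc a : Q \Po ('X + a%:P) != 0.
  by rewrite -size_poly_eq0 size_comp_poly2 ?size_XaddC // size_poly_eq0.
have PQn n : (P \Po ('X + (c *+ n)%:P)) * Q = P * (Q \Po ('X + (c *+ n)%:P)).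
  elim: n => [|n IHn]; first by rewrite mulr0n addr0 !comp_polyXr.
  have := congr1 (comp_poly ('X + c%:P)) IHn; rewrite !comp_polyM -!comp_polyA.
  rewrite comp_polyD comp_polyX comp_polyC -addrA -polyCD -mulrS => e.
  apply: (mulIf (nzQc c)); rewrite mulrAC e mulrAC PQ; ring.
have natc_inj : injective (fun n => c *+ n).
  move=> m n /eqP; wlog le_mn : m n / (m <= n)%N => [hw|].
    by case/orP: (leq_total m n) => h; [|rewrite eq_sym]; move/(hw _ _ h).
  rewrite eq_sym -subr_eq0 -mulrnBr // -mulr_natr mulf_eq0 (negPf nzc) /=.
  rewrite ((pcharf0P _).1 L0) subn_eq0 => le_nm.
  by apply/eqP; rewrite eqn_leq le_mn.
have [s Qs] := roots_finite natc_inj nzQ.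
have [n] : exists n, n \notin s.
  exists (\max_(i <- s) i).+1; apply/negP => /(@leq_bigmax_seq _ _ xpredT id).
  by move=> /(_ isT); rewrite ltnn.
move=> s'n; pose a := c *+ n; have nzQa : Q.[a] != 0.
  by apply: contra s'n; apply: Qs.
exists (P.[a] / Q.[a]); apply/eqP; rewrite -subr_eq0; apply: contraT => nzD.
have natac_inj : injective (fun n => a + c *+ n) by move=> i j /addrI/natc_inj.
have [t Dt] := roots_finite natac_inj nzD.
have [m /negP[]] : exists m, m \notin t.
  exists (\max_(i <- t) i).+1; apply/negP => /(@leq_bigmax_seq _ _ xpredT id).
  by move=> /(_ isT); rewrite ltnn.
apply: Dt; rewrite rootE !hornerE subr_eq0.
have := congr1 (horner^~ a) (PQn m); rewrite !hornerM !horner_comp !hornerE.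
by move=> e; apply/eqP/(mulIf nzQa); rewrite e mulrAC divfK.
Qed.

(** Two shifts of [P / Q] that both equal [P' / Q'] are equal to each other, so [a - b] is a nonzero
    period of [P / Q]. *)
Lemma ratio_two_shifts_constant (L : fieldType) (P Q P' Q' : {poly L}) (a b :
  L) :
    [pchar L] =i pred0 -> Q != 0 -> Q' != 0 -> a != b ->
    (P \Po ('X + a%:P)) * Q' = P' * (Q \Po ('X + a%:P)) ->
    (P \Po ('X + b%:P)) * Q' = P' * (Q \Po ('X + b%:P)) ->
  constant_ratio P Q.
Proof.
move=> L0 nzQ nzQ' ab Ea Eb.
have E : (P \Po ('X + a%:P)) * (Q \Po ('X + b%:P)) =
         (P \Po ('X + b%:P)) * (Q \Po ('X + a%:P)).
  apply: (mulIf nzQ'); rewrite mulrAC Ea mulrAC [RHS]mulrAC Eb; ring.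
apply: (@ratio_shift_constant _ _ _ (a - b)) => //; first by rewrite subr_eq0.
have := congr1 (comp_poly ('X + (- b)%:P)) E.
have shift (p : {poly L}) c d :
    (p \Po ('X + c%:P)) \Po ('X + d%:P) = p \Po ('X + (d + c)%:P).
  by rewrite -comp_polyA comp_polyD comp_polyX comp_polyC -addrA -polyCD.
by rewrite !comp_polyM !shift addNr [- b + a]addrC addr0 !comp_polyXr.
Qed.

(** * Algebraic numbers *)

Lemma irreducible_root_exists (L : numFieldType) (z : L) :
    algebraicOver ratr z ->
  exists p : {poly rat}, irreducible_poly p /\ root (pQto p) z.
Proof.
case=> p; elim: {p}(size p) {-2}p (leqnn (size p)) => [|n IHn] p.
  by rewrite leqn0 size_poly_eq0 => ->.
move=> sz_p nz_p pz; have [irr_p|red_p] := pselect (irreducible_poly p).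
  by exists p.
have gt1_p : (1 < size p)%N.
  by rewrite -(size_map_poly (ratr : {rmorphism rat -> L})) (root_size_gt1 _ pz)
    // map_poly_eq0.
have [q [q1 q_p neq_qp]] : exists q :
  {poly rat}, [/\ size q != 1%N, q %| p & ~~ (q %= p)].
  apply: contrapT => no_q; apply: red_p; split=> // q q1 q_p.
  by apply: contraT => neq_qp; case: no_q; exists q.
have [k Dp] := dvdpP _ _ q_p; have := nz_p; rewrite Dp mulf_eq0 negb_or.
case/andP=> nz_k nz_q; move: pz; rewrite Dp rmorphM rootM.
have lt_qp : (size q < size p)%N.
  by rewrite ltn_neqAle dvdp_leq // dvdp_size_eqp ?neq_qp.
have lt_kp : (size k < size p)%N.
  have gt1_q : (1 < size q)%N by rewrite ltn_neqAle eq_sym q1 size_poly_gt0.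
  rewrite Dp size_mul //.
  by case: (size q) gt1_q => [|[|m]] // _; rewrite !addnS /= ltnS leq_addr.
by case/orP; [apply: (IHn k) | apply: (IHn q)] => //;
  rewrite -ltnS (leq_trans _ sz_p).
Qed.

(** The right-hand side does not mention [z] or [L]: this lets the vanishing of rational polynomials
    pass between roots of [p], even in different fields. *)
Lemma irreducible_root_dvdp (L : numFieldType) (z : L) (p h : {poly rat}) :
  irreducible_poly p -> root (pQto p) z -> root (pQto h) z = (p %| h).
Proof.
move=> irr_p pz; apply/idP/idP=> [hz|/dvdpP[k ->]]; last first.
  by rewrite rmorphM rootM pz orbT.
apply: contraT; rewrite -(irreducible_poly_coprime _ irr_p) =>
  /Bezout_coprimepP.
case=> -[u v] /= uv1; have: root (pQto (u * p + v * h)) z.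
  by rewrite rmorphD !rmorphM /root hornerD !hornerM (rootP pz) (rootP hz)
    !mulr0 addr0.
move: uv1; rewrite -size_poly_eq1 => /eqP sz1 /root_size_gt1.
by rewrite size_map_poly map_poly_eq0 -size_poly_gt0 sz1 => /(_ isT).
Qed.

(** This iterates the primitive element theorem. *)
Lemma common_generator (L : numFieldType) (s : seq L) :
    (forall z, z \in s -> algebraicOver ratr z) ->
  exists2 z, algebraicOver ratr z &
    forall x, x \in s -> exists p : {poly rat}, (pQto p).[z] = x.
Proof.
elim: s => [|x s IHs] alg_s; first by exists 0 => //; exact: algebraic0.
have [|z alg_z gen_z] := IHs.
  by move=> y sy; apply: alg_s; rewrite inE sy orbT.
have alg_x : algebraicOver ratr x by apply: alg_s; rewrite mem_head.
(* The primitive element comes as a difference; using [- z] turns it into the sum [x *+ n + z]. *)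
have [px nz_px px0] := alg_x; have [pz nz_pz pz0] := algebraic_opp alg_z.
have [n [[qz Dqz] [qx Dqx]]] :=
  pchar0_PET nz_pz pz0 nz_px px0 (pchar_num _).
rewrite opprK in Dqz Dqx; exists (x *+ n + z).
  apply: algebraic_add alg_z; rewrite -mulr_natr -(ratr_nat _ n).
  by apply: algebraic_mul alg_x _; apply: algebraic_id.
have gz : (pQto (- qz)).[x *+ n + z] = z by rewrite rmorphN hornerN Dqz opprK.
move=> y; rewrite inE => /predU1P[->|/gen_z[q <-]]; first by exists qx.
by exists (q \Po - qz); rewrite map_comp_poly horner_comp gz.
Qed.

(** In characteristic 0 the derivative of [p] is nonzero and of smaller degree, so the irreducible
    [p] is coprime to it and its roots are simple. *)
Lemma irreducible_roots_algC (p : {poly rat}) : irreducible_poly p ->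
  exists s : seq algC, [/\ uniq s, size s = (size p).-1
    & pQto p %= \prod_(z <- s) ('X - z%:P)].
Proof.
move=> irr_p; have nz_p := irredp_neq0 irr_p.
have [s Dp] := closed_field_poly_normal (pQto p : {poly algC}).
have nz_l : lead_coef (pQto p : {poly algC}) != 0.
  by rewrite lead_coef_eq0 map_poly_eq0.
have Dpz : pQto p %= \prod_(z <- s) ('X - z%:P) by rewrite Dp eqp_scale.
exists s; split.
- rewrite -separable_prod_XsubC -(eqp_separable Dpz).
  rewrite separable_map separable_poly.unlock irreducible_poly_coprime //.
  have gt1_p : (1 < size p)%N by case: irr_p.
  apply/negP=> /dvdp_leq p_dv_p'.
  suff /p_dv_p' : p^`() != 0 by rewrite leqNgt lt_size_deriv.
  apply/eqP=> /polyP/(_ (size p).-2); rewrite coef_deriv coef0 => /eqP.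
  rewrite mulrn_eq0 /= prednK ?ltn_predRL //.
  by rewrite -/(lead_coef p) lead_coef_eq0 (negPf nz_p).
- by have := eqp_size Dpz; rewrite size_map_poly size_prod_XsubC => ->.
- by [].
Qed.

(** The roots of [p] generate a number field that is normal over the rationals. One of its
    automorphisms maps [a] to [b], and it extends to [algC]. *)
Lemma algC_conjugate (p : {poly rat}) (a b : algC) :
    irreducible_poly p -> root (pQto p) a -> root (pQto p) b ->
  exists nu : {rmorphism algC -> algC}, nu a = b.
Proof.
move=> irr_p pa pb; have nz_p := irredp_neq0 irr_p.
have [s [_ _ Dp]] := irreducible_roots_algC irr_p.
have mem_s z : (z \in s) = root (pQto p) z.
  by rewrite (eqp_root Dp) root_prod_XsubC.
have [Qs [QsC [s1 Ds1 gen_s1]]] := num_field_exists s.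
have [a1 Da1 s1a1] : exists2 a1, QsC a1 = a & a1 \in s1.
  by move: pa; rewrite -mem_s -Ds1 => /mapP[a1 ? ->]; exists a1.
have [b1 Db1 s1b1] : exists2 b1, QsC b1 = b & b1 \in s1.
  by move: pb; rewrite -mem_s -Ds1 => /mapP[b1 ? ->]; exists b1.
have QsCalg (q : {poly rat}) : map_poly QsC (map_poly (in_alg Qs) q) = pQto q.
  rewrite -map_poly_comp; apply: eq_map_poly => c /=.
  by rewrite alg_num_field fmorph_rat.
have split_p : splittingFieldFor 1 (map_poly (in_alg Qs) p) {:Qs}.
  exists s1 => //; rewrite -(eqp_map QsC) QsCalg.
  rewrite (eqp_trans Dp) // -Ds1 big_map rmorph_prod.
  rewrite (eq_bigr (fun z => map_poly QsC ('X - z%:P))) ?eqpxx // => z _.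
  by rewrite rmorphB /= map_polyX map_polyC.
have Qs_ax : FieldExt_isSplittingField _ Qs.
  constructor; exists (map_poly (in_alg Qs) p) => //.
  by apply/polyOverP=> i; rewrite coef_map /= rpredZ ?rpred1.
pose Qn : splittingFieldType rat := HB.pack Qs Qs_ax.
have [q Dq] : exists q, minPoly 1 (a1 : Qn) = map_poly (in_alg Qs) q.
  exact/polyOver1P/minPolyOver.
(* As [a] and [b] are both roots of the irreducible [p], a rational polynomial vanishes at [b]
   exactly when it vanishes at [a]. *)
have pb1 : root (minPoly 1 (a1 : Qn)) b1.
  rewrite -(fmorph_root QsC) Dq QsCalg Db1 (irreducible_root_dvdp _ irr_p pb).
  rewrite -(irreducible_root_dvdp _ irr_p pa) -QsCalg -Dq -Da1 fmorph_root.
  exact: root_minPoly.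
have [x _ xa1] :=
  normalField_root_minPoly (sub1v _) (normalFieldf 1) (memvf (a1 : Qn)) pb1.
have [nu Dnu] := extend_algC_subfield_aut QsC x.
by exists nu; rewrite -Da1 -Db1 -Dnu; congr (QsC _).
Qed.

(** * Conjugates of a rational function *)

(** Rational polynomials serve as names for the elements of the field generated by an algebraic [z].
    As a bundled morphism, [eval_at z] also acts on the coefficients of polynomials over such
    names. *)
Definition eval_at (L : numFieldType) (z : L) : {rmorphism {poly rat} -> L} :=
  horner_eval z \o map_poly ratr.

Lemma eval_at_comp (L : numFieldType) (z : L) (g h : {poly rat}) :
  eval_at z (g \Po h) = (pQto g).[eval_at z h].
Proof. by rewrite /eval_at /= /horner_eval map_comp_poly horner_comp. Qed.

Lemma eval_at_affine (L : numFieldType) (z : L) (q r : rat) (h : {poly rat}) :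
  eval_at z (q%:P + r *: h) = ratr q + ratr r * eval_at z h.
Proof.
rewrite /eval_at /= /horner_eval rmorphD hornerD /= map_polyC hornerC.
by rewrite map_polyZ hornerZ.
Qed.

Lemma eval_at_eq0 (L : numFieldType) (z : L) (h : {poly rat}) :
  (eval_at z h == 0) = root (pQto h) z.
Proof. by []. Qed.

(** Any root [z1] in [algC] of an irreducible annihilator of [z] satisfies the same rational
    equations. Inverses, obtained from Bezout, are again polynomials in the generator, so that
    quotients can be transferred too. *)
Lemma algC_copy (L : numFieldType) (z : L) : algebraicOver ratr z ->
  exists z1 : algC,
    (forall h, (eval_at z h == 0) = (eval_at z1 h == 0)) /\
    (forall h, eval_at z h != 0 -> exists k, eval_at z (h * k) = 1).
Proof.
case/irreducible_root_exists=> p [irr_p pz].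
have [z1 pz1] : exists z1 : algC, root (pQto p) z1.
  apply: closed_rootP; rewrite size_map_poly gtn_eqF //; first by case: irr_p.
exists z1; split=> h; rewrite !eval_at_eq0 (irreducible_root_dvdp _ irr_p pz).
  by rewrite (irreducible_root_dvdp _ irr_p pz1).
rewrite -(irreducible_poly_coprime _ irr_p) =>
  /Bezout_eq1_coprimepP[[u v] /= uv1].
exists v; rewrite mulrC -[RHS](rmorph1 (eval_at z)) -uv1 rmorphD.
have ez0 : eval_at z p = 0 by apply/eqP; rewrite eval_at_eq0.
by rewrite [X in _ = X + _]rmorphM ez0 mulr0 add0r.
Qed.

Lemma constant_ratio_map (K L : fieldType) (f : {rmorphism K -> L})
    (P Q : {poly K}) : Q != 0 ->
  constant_ratio (map_poly f P) (map_poly f Q) -> constant_ratio P Q.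
Proof.
move=> nzQ; rewrite !constant_ratioP ?map_poly_eq0 // => PQ i j.
by apply: (fmorph_inj f); rewrite !rmorphM /= -!coef_map PQ.
Qed.

Section ConjugateRatios.

Variables (P Q : {poly algC}) (rs : seq algC).
Variable nu : algC -> {rmorphism algC -> algC}.
Hypotheses (nzQ : Q != 0) (nconst : ~ constant_ratio P Q).

(** If [nu rho] maps [a] to [rho], the value at a rational [q] is the image under [nu rho] of the
    value of [F] at [q + r a]. *)
Let shifted (F : {poly algC}) (r : rat) (rho : algC) : {poly algC} :=
  map_poly (nu rho) F \Po ('X + (ratr r * rho)%:P).

(** The cross-multiplied difference of two conjugates of [P / Q], as a polynomial in [q]. *)
Let discrepancy r rho rho' :=
  shifted P r rho * shifted Q r rho' - shifted P r rho' * shifted Q r rho.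

(** At most one [r] is exceptional: two of them would exhibit one rational function as two different
    shifts of another. *)
Let discrepancy_neq0 rho rho' : rho != rho' ->
  almost_all (fun r => discrepancy r rho rho' != 0).
Proof.
move=> neq_rho.
have [[r0 H0]|noH] := pselect (exists r, discrepancy r rho rho' = 0);
  last first.
  by exists [::] => r _; apply/eqP=> Hr; case: noH; exists r.
exists [:: r0] => r; rewrite inE => neq_r; apply/eqP => Hr.
apply: nconst; apply: (constant_ratio_map (f := nu rho) nzQ).
(* Translating by [- t rho'] removes the shift on the side of [rho'] and leaves [c t] on the side of
   [rho]. *)
pose c t : algC := ratr t * (rho - rho').
have Hc t : discrepancy t rho rho' = 0 ->
    (map_poly (nu rho) P \Po ('X + (c t)%:P)) * map_poly (nu rho') Q =
    map_poly (nu rho') P * (map_poly (nu rho) Q \Po ('X + (c t)%:P)).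
  move=> /(congr1 (comp_poly ('X + (- (ratr t * rho'))%:P))).
  rewrite comp_poly0 comp_polyB !comp_polyM /shifted -!comp_polyA.
  rewrite !comp_polyD !comp_polyX !comp_polyC -!addrA -!polyCD addNr.
  rewrite [- _ + _]addrC -mulrBr addr0 !comp_polyXr => /eqP.
  by rewrite subr_eq0 => /eqP.
apply: (@ratio_two_shifts_constant _ _ _ _ _ (c r) (c r0)); last 2 first.
- exact: Hc Hr.
- exact: Hc H0.
- exact: pchar_num.
- by rewrite map_poly_eq0.
- by rewrite map_poly_eq0.
- rewrite -subr_eq0 -mulrBl mulf_eq0 !subr_eq0 (negPf neq_rho) orbF.
  by rewrite (inj_eq (fmorph_inj _)).
Qed.

(** For each of the finitely many pairs of conjugates, exclude the bad [r], then the rational roots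
    [q] of the nonzero discrepancy. *)
Lemma conjugate_ratios_distinct :
  almost_all (fun r => almost_all (fun q => forall rho rho',
    rho \in rs -> rho' \in rs -> rho != rho' ->
    let x t : algC := ratr q + ratr r * t in
    (map_poly (nu rho) P).[x rho] * (map_poly (nu rho') Q).[x rho'] !=
    (map_poly (nu rho') P).[x rho'] * (map_poly (nu rho) Q).[x rho])).
Proof.
have good r rho rho' : discrepancy r rho rho' != 0 ->
    almost_all (fun q => (discrepancy r rho rho').[ratr q] != 0).
  move=> nzH; have [s sH] :=
    roots_finite (fmorph_inj (ratr : {rmorphism rat -> algC})) nzH.
  by exists s => q; apply: contra => /sH.
suff: almost_all (fun r => almost_all (fun q => forall rho, rho \in rs ->
    forall rho', rho' \in rs -> rho != rho' ->
    (discrepancy r rho rho').[ratr q] != 0)).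
  apply: almost_allS => r; apply: almost_allS => q H rho rho' s1 s2 neq /=.
  have := H _ s1 _ s2 neq; rewrite /discrepancy hornerD hornerN !hornerM.
  by rewrite !horner_comp !hornerE subr_eq0.
have := @almost_all_seq _ rs (fun rho r => forall rho', rho' \in rs ->
   rho != rho' -> discrepancy r rho rho' != 0).
move=> h; have {h} : almost_all (fun r => forall rho, rho \in rs ->
    forall rho', rho' \in rs -> rho != rho' -> discrepancy r rho rho' != 0).
  apply: h => rho _; apply: almost_all_seq => rho' _.
  have [->|neq] := eqVneq rho rho'; first by exists [::].
  by apply: almost_allS (discrepancy_neq0 neq).
apply: almost_allS => r H; apply: almost_all_seq => rho s1.
apply: almost_all_seq => rho' s2.
have [->|neq] := eqVneq rho rho'; first by exists [::].
by apply: almost_allS (good _ _ _ (H _ s1 _ s2 neq)).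
Qed.

End ConjugateRatios.

(** [L] may lack automorphisms, so [a] and all coefficients are written as polynomials in one
    generator [z] and copied into [algC]. There the value has as many distinct conjugates as [m] has
    roots, and each is a root of [g]. *)
Lemma algebraic_ratio_degree (L : numFieldType) (m : {poly rat}) (a : L)
    (P Q : {poly L}) :
    irreducible_poly m -> root (pQto m) a ->
    (forall i, algebraicOver ratr P`_i) ->
      (forall i, algebraicOver ratr Q`_i) ->
    Q != 0 -> ~ constant_ratio P Q ->
  almost_all (fun r => almost_all (fun q =>
    let x := ratr q + ratr r * a in Q.[x] != 0 ->
    forall g : {poly rat}, g != 0 -> (size g < size m)%N ->
    ~~ root (pQto g) (P.[x] / Q.[x]))).
Proof.
move=> irr_m ma algP algQ nzQ nconst.
have [|z alg_z gen_z] := @common_generator _ (a :: P ++ Q).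
  move=> y; rewrite inE mem_cat =>
    /or3P[/eqP->|/(nthP 0)[i _ <-]//|/(nthP 0)[i _ <-]//].
  by exists m => //; apply: irredp_neq0.
have [z1 [z_z1 inv_z]] := algC_copy alg_z.
pose e := eval_at z; pose e1 := eval_at z1.
have eq_e h k : e h = e k -> e1 h = e1 k.
  by move/eqP; rewrite -subr_eq0 -rmorphB z_z1 rmorphB subr_eq0 => /eqP.
have coef_e (F : {poly {poly rat}}) i : (map_poly e F)`_i = e F`_i.
  exact: coef_map.
have coef_e1 (F : {poly {poly rat}}) i : (map_poly e1 F)`_i = e1 F`_i.
  exact: coef_map.
(* [h] chooses a name in terms of [z] for each number. The normalization [h 0 = 0] makes
   [map_poly h] act coefficientwise, although [h] is not a morphism. *)
have [h [h0 eh]] : exists h : L -> {poly rat}, h 0 = 0 /\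
    forall y, y \in a :: P ++ Q -> e (h y) = y.
  have /choice[h eh] : forall y, exists p, y \in a :: P ++ Q -> e p = y.
    move=> y; have [/gen_z[p ez]|] := boolP (y \in a :: P ++ Q);
      last by exists 0.
    by exists p.
  exists (fun y => if y == 0 then 0 else h y); rewrite eqxx; split=> // y sy.
  by have [->|_] := eqVneq y 0; [rewrite rmorph0 | apply: eh].
have lift (F : {poly L}) : {subset (F : seq L) <= a :: P ++ Q} ->
    map_poly e (map_poly h F) = F.
  move=> sF; apply/polyP => i; rewrite coef_e.
  have -> : (map_poly h F)`_i = h F`_i by exact: coef_map_id0.
  have [ltiF|leFi] := ltnP i (size F);
    last by rewrite nth_default // h0 rmorph0.
  by apply: eh; rewrite sF ?mem_nth.
set Pb := map_poly h P in lift *; pose Qb := map_poly h Q; pose ab := h a.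
have DP : map_poly e Pb = P.
  by apply: lift => y Py; rewrite inE mem_cat Py orbT.
have DQ : map_poly e Qb = Q.
  by apply: lift => y Py; rewrite inE mem_cat Py !orbT.
have Da : e ab = a by rewrite eh ?mem_head.
pose P1 := map_poly e1 Pb; pose Q1 := map_poly e1 Qb.
have e0 h1 : (e h1 == 0) = (e1 h1 == 0) by exact: z_z1.
have nzQ1 : Q1 != 0.
  apply: contra_neq nzQ => /polyP Q0; apply/polyP => i;
    rewrite -DQ coef_e coef0.
  by apply/eqP; rewrite e0 -coef_e1 Q0 coef0.
have nconst1 : ~ constant_ratio P1 Q1.
  rewrite constant_ratioP // => PQ; apply/nconst/constant_ratioP => // i j.
  rewrite -DP -DQ !coef_e -!rmorphM; apply/eqP.
  rewrite -subr_eq0 -rmorphB e0 rmorphB subr_eq0 !rmorphM -!coef_e1.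
  by apply/eqP/PQ.
have [rs [uniq_rs sz_rs Dm]] := irreducible_roots_algC irr_m.
have mem_rs y : (y \in rs) = root (pQto m) y.
  by rewrite (eqp_root Dm) root_prod_XsubC.
have m1a : root (pQto m) (e1 ab).
  by rewrite /root -eval_at_comp -z_z1 eval_at_comp [eval_at z ab]Da.
have /choice[nu Dnu] : forall rho, exists nu : {rmorphism algC -> algC},
    rho \in rs -> nu (e1 ab) = rho.
  move=> rho; have [|_] := boolP (rho \in rs); last by exists idfun.
  by rewrite mem_rs => /(algC_conjugate irr_m m1a)[nu Dnu]; exists nu.
have := conjugate_ratios_distinct rs nu nzQ1 nconst1.
apply: almost_allS => r; apply: almost_allS => q distinct x nzQx g nz_g sz_g.
apply/negP => g0.
pose xb : {poly rat} := q%:P + r *: ab.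
have Dx : e xb = x by rewrite eval_at_affine [eval_at z ab]Da.
have Dx1 : e1 xb = ratr q + ratr r * e1 ab by exact: eval_at_affine.
have eF (F : {poly {poly rat}}) : e F.[xb] = (map_poly e F).[x].
  by rewrite -Dx horner_map.
have [|k ek] := inv_z Qb.[xb]; first by rewrite eF DQ.
have nzQ1x : Q1.[e1 xb] != 0 by rewrite horner_map -e0 eF DQ.
have e1k : e1 (Qb.[xb] * k) = 1.
  by rewrite -(rmorph1 e1); apply: eq_e; rewrite ek rmorph1.
(* With [k] naming the inverse of [Q.[x]], [b] names the quotient [P.[x] / Q.[x]]. *)
pose b := Pb.[xb] * k.
have Db : e b = P.[x] / Q.[x].
  apply: (mulIf nzQx); rewrite divfK // rmorphM -{1}DQ -eF mulrAC -mulrA.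
  by rewrite -rmorphM ek mulr1 eF DP.
have Db1 : e1 b * Q1.[e1 xb] = P1.[e1 xb].
  by rewrite horner_map -rmorphM /b mulrAC -mulrA rmorphM e1k mulr1 -horner_map.
have g1 : root (pQto g) (e1 b).
  by rewrite /root -eval_at_comp -z_z1 eval_at_comp [eval_at z b]Db.
(* The conjugates of the value would be more roots than the degree of [g] allows. *)
have := @max_poly_roots _ (pQto g) [seq nu rho (e1 b) | rho <- rs].
rewrite map_poly_eq0 size_map size_map_poly sz_rs => /(_ nz_g) lt_g.
suff : ((size m).-1 < size g)%N by move: sz_g; case: (size m) => // n; lia.
apply: lt_g.
  apply/allP => _ /mapP[rho _ ->]; move: g1.
  rewrite -(fmorph_root (nu rho)) -map_poly_comp.
  by rewrite (eq_map_poly (g := ratr)) // => c; rewrite /= fmorph_rat.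
(* [nu rho] fixes the rationals and maps [e1 ab] to [rho], hence maps the copy of [x] to
   [q + r rho]. *)
have nuF rho (F : {poly algC}) : rho \in rs ->
    (map_poly (nu rho) F).[ratr q + ratr r * rho] = nu rho F.[e1 xb].
  move=> /Dnu Drho; rewrite -horner_map Dx1; congr _.[_].
  transitivity (nu rho (ratr q) + nu rho (ratr r) * nu rho (e1 ab)).
    by rewrite Drho !fmorph_rat.
  by rewrite -rmorphM -rmorphD.
rewrite map_inj_in_uniq // => rho rho' s1 s2 eq_nu; apply/eqP;
  apply: contraT => neq.
have /= := distinct _ _ s1 s2 neq; rewrite !nuF // -Db1.
move: (e1 b) (Q1.[e1 xb]) eq_nu => u w eq_nu.
by rewrite !rmorphM eq_nu mulrAC eqxx.
Qed.

(** * Rational functions with transcendental coefficients *)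

Section AlgebraicSubfield.

Variable L : numFieldType.

Definition algebraic_numbers : {pred L} := fun x => `[< algebraicOver ratr x >].

Lemma algebraic_numbersP x :
  reflect (algebraicOver ratr x) (x \in algebraic_numbers).
Proof. exact: asboolP. Qed.

Fact algebraic_numbers_divring : divring_closed algebraic_numbers.
Proof.
split=> [|x y /algebraic_numbersP ax /algebraic_numbersP ay
         |x y /algebraic_numbersP ax /algebraic_numbersP ay];
  apply/algebraic_numbersP.
- exact: algebraic1.
- exact: algebraic_sub.
- exact: algebraic_div.
Qed.

HB.instance Definition _ :=
  GRing.isDivringClosed.Build L algebraic_numbers algebraic_numbers_divring.

(** A field type for the algebraic elements makes linear algebra over them available. *)
Definition alg_number : Type := {x : L | x \in algebraic_numbers}.

HB.instance Definition _ := SubChoice.on alg_number.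
HB.instance Definition _ := [SubChoice_isSubIntegralDomain of alg_number by <:].
HB.instance Definition _ := [SubIntegralDomain_isSubField of alg_number by <:].

End AlgebraicSubfield.

(** The rank of a matrix does not change under field extension, so a nonzero kernel over [L] forces
    one over the algebraic elements. *)
Lemma algebraic_kernel (L : numFieldType) m n (A : 'M[L]_(m, n)) (v :
  'cV[L]_n) :
    (forall i j, algebraicOver ratr (A i j)) -> A *m v = 0 -> v != 0 ->
  exists w : 'cV[L]_n,
    [/\ forall i j, algebraicOver ratr (w i j), A *m w = 0 & w != 0].
Proof.
move=> algA Av nzv.
pose val' : {rmorphism alg_number L -> L} := val.
pose B : 'M[alg_number L]_(m, n) := \matrix_(i, j)
  Sub (A i j) (introT (algebraic_numbersP (A i j)) (algA i j)).
have DA : A = map_mx val' B by apply/matrixP => i j; rewrite !mxE.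
have rkA : (\rank A < n)%N.
  rewrite ltn_neqAle rank_leq_col andbT; apply: contra nzv => /eqP rkA.
  have : row_free A^T by rewrite /row_free mxrank_tr rkA.
  move/row_free_inj=> /(_ _ v^T 0) /(_ _) injA;
    rewrite -[v]trmxK injA ?trmx0 //.
  by rewrite -trmx_mul Av trmx0 mul0mx.
have : cokermx B != 0.
  by rewrite -mxrank_eq0 mxrank_coker -(mxrank_map val') -DA subn_eq0 -ltnNge.
case/matrix0Pn=> i [j nzBij]; exists (map_mx val' (col j (cokermx B))); split.
- by move=> k l; rewrite mxE; apply/algebraic_numbersP/valP.
- by rewrite DA -map_mxM !colE mulmxA mulmx_coker mul0mx map_mx0.
- rewrite map_mx_eq0; apply: contra nzBij => /eqP/matrixP/(_ i 0).
  by rewrite !mxE => ->.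
Qed.

(** Given enough algebraic points with algebraic values, the coefficients of [P] and [Q] solve a
    homogeneous linear system with algebraic entries. A nonzero algebraic solution then gives the
    same fraction. *)
Lemma ratio_algebraic_or_finite (L : numFieldType) (P Q : {poly L}) : Q != 0 ->
  (exists P1 Q1 : {poly L},
     [/\ forall i, algebraicOver ratr P1`_i, forall i, algebraicOver ratr Q1`_i,
         Q1 != 0 & P * Q1 = P1 * Q]) \/
  exists s : seq L, forall x, algebraicOver ratr x -> Q.[x] != 0 ->
    algebraicOver ratr (P.[x] / Q.[x]) -> x \in s.
Proof.
move=> nzQ; pose bad x :=
  [/\ algebraicOver ratr x, Q.[x] != 0 & algebraicOver ratr (P.[x] / Q.[x])].
(* [N + N] is the number of unknown coefficients, and it also exceeds the degree of
   [P * Q1 - P1 * Q]. *)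
pose N := maxn (size P) (size Q); pose n := (N + N)%N.
have [[s [us bad_s sz_s]]|no_s] := pselect (exists s,
    [/\ uniq s, forall x, x \in s -> bad x & (n <= size s)%N]); last first.
  right; have [|s Hs] := @finite_of_bounded _ bad n.
    by move=> s us bad_s; rewrite ltnNge; apply/negP=> sz_s; case: no_s;
      exists s.
  by exists s => x *; apply: Hs.
left; pose b x := P.[x] / Q.[x].
pose A : 'M[L]_(size s, N + N) := row_mx
  (\matrix_(i, j) s`_i ^+ j) (\matrix_(i, j) (- (b s`_i * s`_i ^+ j))).
have coefsE (F : {poly L}) x : (size F <= N)%N ->
    F.[x] = \sum_(j < N) F`_j * x ^+ j by exact: horner_coef_wide.
pose v : 'cV[L]_(N + N) := col_mx (\col_j P`_j) (\col_j Q`_j).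
have algX (x : L) k : algebraicOver ratr x -> algebraicOver ratr (x ^+ k).
  move=> ax; elim: k => [|k IHk]; first exact: algebraic1.
  by rewrite exprS; apply: algebraic_mul.
have algA i j : algebraicOver ratr (A i j).
  have [ax _ ab] := bad_s _ (mem_nth 0 (ltn_ord i)).
  rewrite mxE; case: split => k; rewrite !mxE; first exact: algX.
  by apply: algebraic_opp; apply: algebraic_mul => //; apply: algX.
have AE (F G : {poly L}) i :
    (A *m col_mx (\col_j F`_j) (\col_j G`_j)) i 0 =
    (\sum_(j < N) F`_j * s`_i ^+ j) - b s`_i * \sum_(j < N) G`_j * s`_i ^+ j.
  rewrite mul_row_col mxE; congr (_ + _); rewrite mxE.
    by apply: eq_bigr => j _; rewrite !mxE mulrC.
  rewrite mulr_sumr -sumrN; apply: eq_bigr => j _; rewrite !mxE; ring.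
have Av : A *m v = 0.
  apply/colP => i; rewrite AE -!coefsE ?leq_maxl ?leq_maxr // mxE.
  have [_ nzQs _] := bad_s _ (mem_nth 0 (ltn_ord i)).
  by rewrite divfK // subrr.
have nzv : v != 0.
  apply: contra_neq nzQ => v0; apply/polyP=> i; rewrite coef0.
  have [leQi|ltiQ] := leqP (size Q) i; first by rewrite nth_default.
  have ltiN : (i < N)%N by rewrite (leq_trans ltiQ) ?leq_maxr.
  have := congr1 (fun u : 'cV_(N + N) => u (rshift N (Ordinal ltiN)) 0) v0.
  by rewrite col_mxEd !mxE.
have [w [algw Aw nzw]] := algebraic_kernel algA Av nzv.
pose P1 := \poly_(i < N) (if insub i is Some j then w (lshift N j) 0 else 0).
pose Q1 := \poly_(i < N) (if insub i is Some j then w (rshift N j) 0 else 0).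
have coefP1 (j : 'I_N) :
  P1`_j = w (lshift N j) 0 by rewrite coef_poly ltn_ord valK.
have coefQ1 (j : 'I_N) :
  Q1`_j = w (rshift N j) 0 by rewrite coef_poly ltn_ord valK.
have Dw : w = col_mx (\col_j P1`_j) (\col_j Q1`_j).
  rewrite -[w]vsubmxK; congr col_mx; apply/colP => j; rewrite !mxE.
    by rewrite coefP1.
  by rewrite coefQ1.
have szP1 : (size P1 <= N)%N := size_poly _ _.
have szQ1 : (size Q1 <= N)%N := size_poly _ _.
have alg1 i : algebraicOver ratr P1`_i /\ algebraicOver ratr Q1`_i.
  rewrite !coef_poly; case: ifP => [ltiN|_]; last by split; apply: algebraic0.
  by rewrite insubT.
(* The difference vanishes at all the points of [s], which are too many for its degree. *)
have PQ : P * Q1 = P1 * Q.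
  apply/eqP; rewrite -subr_eq0; apply: contraT => nzD.
  have : (size s < size (P * Q1 - P1 * Q)%R)%N.
    apply: max_poly_roots us => //; apply/allP => x sx.
    have [_ nzQx _] := bad_s x sx; rewrite /root hornerD hornerN !hornerM.
    have := congr1 (fun u : 'cV_(size s) =>
      u (Ordinal (introT idP (etrans (index_mem x s) sx))) 0) Aw.
    rewrite Dw AE -!coefsE // mxE /= nth_index // => /eqP;
      rewrite subr_eq0 => /eqP ->.
    by rewrite /b; apply/eqP; field.
  rewrite ltnNge (leq_trans _ sz_s) // (leq_trans (size_polyD _ _)) //
    size_polyN.
  rewrite geq_max !(leq_trans (size_polyMleq _ _)) //.
    by rewrite (leq_trans (leq_pred _)) // leq_add // leq_maxr.
  by rewrite (leq_trans (leq_pred _)) // leq_add // leq_maxl.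
exists P1, Q1; split=> //; try by move=> i; case: (alg1 i).
(* If [Q1] were 0, then [P1 * Q = 0] would give [P1 = 0], and the solution [w] would be zero. *)
apply: contra_neq nzw => Q0; rewrite Dw Q0.
have /eqP : P1 * Q = 0 by rewrite -PQ Q0 mulr0.
rewrite mulf_eq0 (negPf nzQ) orbF => /eqP ->.
by rewrite -col_mx0; congr col_mx; apply/colP => j; rewrite !mxE coef0.
Qed.

(** Either the fraction can be rewritten with algebraic coefficients, or it is transcendental at all
    but finitely many algebraic points where it is defined. In the latter case every [r] is good. *)
Lemma ratio_degree (L : numFieldType) (m : {poly rat}) (a : L)
    (P Q : {poly L}) :
    irreducible_poly m -> root (pQto m) a -> Q != 0 -> ~ constant_ratio P Q ->
  almost_all (fun r => almost_all (fun q =>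
    let x := ratr q + ratr r * a in Q.[x] != 0 ->
    forall g : {poly rat}, g != 0 -> (size g < size m)%N ->
    ~~ root (pQto g) (P.[x] / Q.[x]))).
Proof.
move=> irr_m ma nzQ nconst.
have line_inj r : injective (fun q : rat => ratr q + ratr r * a : L).
  by move=> q q' /addIr /(fmorph_inj (ratr : {rmorphism rat -> L})).
have [[P1 [Q1 [algP1 algQ1 nzQ1 PQ]]]|[s fin_s]] :=
  ratio_algebraic_or_finite P nzQ.
  have nconst1 : ~ constant_ratio P1 Q1.
    case=> c DP1; apply: nconst; exists c; apply: (mulIf nzQ1).
    by rewrite PQ DP1 -!scalerAl mulrC.
  have := algebraic_ratio_degree irr_m ma algP1 algQ1 nzQ1 nconst1.
  apply: almost_allS => r good_r.
  have [t Ht] := roots_finite (line_inj r) nzQ1.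
  have : almost_all (fun q => Q1.[ratr q + ratr r * a] != 0).
    by exists t => q; apply: contra => /Ht.
  move/(almost_allI good_r);
    apply: almost_allS => q [good nzQ1x] x nzQx g nz_g sz_g.
  suff -> : P.[x] / Q.[x] = P1.[x] / Q1.[x] by apply: good.
  apply: (mulIf nzQx); rewrite divfK // mulrAC.
  by apply: (mulIf nzQ1x); rewrite divfK // -!hornerM PQ.
exists [::] => r _; pose p := \prod_(z <- s) ('X - z%:P).
have nz_p : p != 0 by rewrite monic_neq0 ?monic_prod_XsubC.
have [t Ht] := roots_finite (line_inj r) nz_p.
exists t => q; move=> t'q x nzQx g nz_g _; apply: contra t'q => g0; apply: Ht.
rewrite root_prod_XsubC; apply: fin_s => //; last by exists g.
have algQ c : algebraicOver ratr (ratr c : L) by apply: algebraic_id.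
apply: algebraic_add => //; apply: algebraic_mul => //.
by exists m => //; apply: irredp_neq0.
Qed.

(** * Degrees of real algebraic numbers *)

Lemma irreducible_alg_eq (R : realType) (p : {poly rat}) (x : R) :
  irreducible_poly p -> root (pQto p) x -> alg_eq R (size p).-1 x.
Proof.
move=> irr_p px; have nz_p := irredp_neq0 irr_p.
have nz_l : (lead_coef p)^-1 != 0 by rewrite invr_eq0 lead_coef_eq0.
exists ((lead_coef p)^-1 *: p); last first.
  by rewrite size_scale // prednK ?size_poly_gt0.
split; first by rewrite monicE lead_coefZ mulVf ?lead_coef_eq0.
  by rewrite map_polyZ rootZ ?fmorph_eq0.
move=> q nz_q qx; rewrite size_scale // dvdp_leq //.
by rewrite -(irreducible_root_dvdp _ irr_p px).
Qed.

(** This trades minimal polynomials for arbitrary annihilators, the form in which degree bounds are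
    obtained and refuted. *)
Lemma alg_leP (R : realType) (n : nat) (x : R) :
  alg_le R n x <->
  exists g : {poly rat}, [/\ g != 0, root (pQto g) x & (size g <= n.+1)%N].
Proof.
split=> [[c /= le_cn [p [mon_p px _] sz_p]]|[g [nz_g gx sz_g]]].
  by exists p; rewrite monic_neq0 // sz_p ltnS.
have [p [irr_p px]] : exists p, irreducible_poly p /\ root (pQto p) x.
  by apply: irreducible_root_exists; exists g.
exists (size p).-1; last exact: irreducible_alg_eq.
rewrite /= -ltnS prednK ?size_poly_gt0 ?irredp_neq0 //.
by rewrite (leq_trans _ sz_g) // dvdp_leq //
  -(irreducible_root_dvdp _ irr_p px).
Qed.

(** Substituting a rational affine map of nonzero slope preserves the size of a polynomial, and
    annihilators pass both ways between [a] and [q + r a]. *)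
Lemma alg_eq_affine (R : realType) (m : {poly rat}) (a : R) (q r : rat) :
    irreducible_poly m -> root (pQto m) a -> r != 0 ->
  alg_eq R (size m).-1 (ratr q + ratr r * a).
Proof.
move=> irr_m ma nz_r; pose x : R := ratr q + ratr r * a.
have nz_rR : ratr r != 0 :> R by rewrite fmorph_eq0.
have affine_root (g : {poly rat}) (u v : rat) (y : R) :
    root (pQto (g \Po (v *: 'X + u%:P))) y = root (pQto g) (ratr u + ratr v *
      y).
  rewrite /root map_comp_poly horner_comp rmorphD /= map_polyZ map_polyX
    map_polyC.
  by rewrite !hornerE addrC.
have sz_affine (g : {poly rat}) (u v : rat) : v != 0 ->
    size (g \Po (v *: 'X + u%:P)) = size g.
  move=> nz_v; apply: size_comp_poly2;
    rewrite size_polyDl size_scale ?size_polyX //.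
  by rewrite ltnS (leq_trans (size_polyC_leq1 _)).
have [c le_c Dc] : alg_le R (size m).-1 x.
  apply/alg_leP; exists (m \Po (r^-1 *: 'X + (- (q / r))%:P)).
  rewrite -size_poly_eq0 sz_affine ?invr_eq0 // size_poly_eq0 irredp_neq0 //.
  rewrite affine_root prednK ?size_poly_gt0 ?irredp_neq0 //; split=> //.
  suff -> : ratr (- (q / r)) + ratr r^-1 * x = a :> R by [].
  by rewrite /x rmorphN rmorphM fmorphV /=; field.
suff <- : c = (size m).-1 by [].
apply/eqP; rewrite eqn_leq le_c leqNgt; apply/negP => lt_c.
have : alg_le R c x by exists c => /=.
case/alg_leP=> g [nz_g gx sz_g]; pose h := g \Po (r *: 'X + q%:P).
have hm : m %| h by rewrite -(irreducible_root_dvdp _ irr_m ma) affine_root.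
have /dvdp_leq/(_ hm) : h != 0 by rewrite -size_poly_eq0 sz_affine //
  size_poly_eq0.
rewrite sz_affine // leqNgt => /negP[]; apply: leq_ltn_trans sz_g _.
by move: lt_c; case: (size m).
Qed.

(** The polynomial ['X^d - 2] is irreducible by Eisenstein at 2 and changes sign on the interval
    from 0 to 2. *)
Lemma irreducible_real_root (R : realType) (d : nat) : (0 < d)%N ->
  exists m : {poly rat}, [/\ irreducible_poly m, size m = d.+1 &
    exists a : R, root (pQto m) a].
Proof.
move=> d_gt0; pose m : {poly int} := 'X^d - 2%:P; exists (map_poly intr m).
have sz_m : size m = d.+1 by rewrite size_XnsubC.
split.
- apply/irreducible_rat_int/(@eisenstein_crit 2) => //.
  + by rewrite sz_m; case: (d) d_gt0.
  + by rewrite lead_coefXnsubC.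
  + by rewrite coefB coefXn coefC eqxx; case: (d) d_gt0.
  + move=> i; rewrite sz_m /= coefB coefXn coefC => lt_id.
    by rewrite (ltn_eqF lt_id) sub0r; case: eqP.
- by rewrite size_map_poly_id0 ?sz_m // lead_coefXnsubC.
- have [||a _ a0] := @poly_ivt R ('X^d - 2%:P) 0 2.
  + by rewrite ler0n.
  + rewrite !hornerE expr0n gtn_eqF //= sub0r oppr_le0 ler0n /=.
    by rewrite subr_ge0 -[X in X <= _]expr1 ler_eXn2l // ltr1n.
  exists a; suff -> : pQto (map_poly intr m) = 'X^d - 2%:P :> {poly R} by [].
  by rewrite !rmorphB /= !map_polyXn !map_polyC /= !rmorph_nat.
Qed.

(** * Rational functions at a generic point *)

(** Cantor's nested intervals: the supremum of the left ends lies in every interval, and the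
    interval of index [n.+1] avoids [u n]. *)
Lemma exists_notin_sequence (R : realType) (u : nat -> R) :
  exists y, forall n, y != u n.
Proof.
(* In the second case the right end drops below the midpoint [c], so that the closed interval also
   misses [v = c]. *)
pose shrink (ab : R * R) v := let c := (ab.1 + ab.2) / 2 in
  if v < c then (c, ab.2) else (ab.1, (ab.1 + c) / 2).
have shrinkP ab v : ab.1 < ab.2 ->
    [/\ ab.1 <= (shrink ab v).1, (shrink ab v).1 < (shrink ab v).2,
        (shrink ab v).2 <= ab.2 & ~~ ((shrink ab v).1 <= v <= (shrink ab v).2)].
  by case: ab => a b /= lt_ab; rewrite /shrink /=; case: ltP => /= ?; split;
    lra.
pose itv := fix loop n := if n is k.+1 then shrink (loop k) (u k) else (0, 1).
have lt_itv n : (itv n).1 < (itv n).2.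
  by elim: n => [|n IHn]; [exact: ltr01 | case: (shrinkP _ (u n) IHn)].
have le_itv m n : (itv m).1 <= (itv (m + n)%N).1 /\
  (itv (m + n)%N).2 <= (itv m).2.
  elim: n => [|n [IH1 IH2]]; first by rewrite addn0.
  rewrite addnS /=; have [le1 _ le2 _] :=
    shrinkP _ (u (m + n)%N) (lt_itv (m + n)%N).
  by split; [apply: le_trans le1 | apply: le_trans IH2].
have le12 m n : (itv m).1 <= (itv n).2.
  have [le_m _] := le_itv m n; have [_ le_n] := le_itv n m.
  by rewrite (le_trans le_m) // (le_trans (ltW (lt_itv _))) // addnC.
pose A : set R := range (fun n => (itv n).1).
have A_ub n : ubound A (itv n).2 by move=> _ [m _ <-].
have A0 : (A !=set0)%classic by exists (itv 0).1, 0%N.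
exists (sup A) => n; apply: contraTneq isT => Dsup.
have [_ _ _ /negP[]] := shrinkP _ (u n) (lt_itv n).
rewrite -[X in _ <= X <= _]Dsup; apply/andP; split.
  apply: ub_le_sup; first by exists (itv 0).2; apply: A_ub.
  by exists n.+1.
by apply: ge_sup => //; apply: (A_ub n.+1).
Qed.

Lemma exists_notin_countable (R : realType) (I : countType) (B : I -> seq R) :
  exists y, forall i, y \notin B i.
Proof.
pose u n := if unpickle n is Some ij then nth 0 (B ij.1) ij.2 else 0.
have [y Hy] := exists_notin_sequence u; exists y => i; apply/negP=> By.
by have := Hy (pickle (i, index y (B i)));
  rewrite /u pickleK /= nth_index ?eqxx.
Qed.

Lemma mem_rootsR (R : rcfType) (p : {poly R}) x : p != 0 ->
  (x \in rootsR p) = root p x.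
Proof. by move=> /roots_on_rootsR/(_ x) <-. Qed.

(** The zero polynomial has constant sign; the others are nonzero at [y] and keep their sign nearby
    by continuity. *)
Lemma sgr_horner_near (R : rcfType) (s : seq {poly R}) (y : R) :
    (forall p, p \in s -> p != 0 -> p.[y] != 0) ->
  exists2 e, 0 < e &
    forall x p, `|x - y| < e -> p \in s -> Num.sg p.[x] = Num.sg p.[y].
Proof.
elim: s => [|p s IHs] ny; first by exists 1.
have [|e1 e1_gt0 He1] := IHs; first by move=> q sq; apply: ny;
  rewrite inE sq orbT.
have [->|nzp] := eqVneq p 0.
  exists e1 => // x q ne; rewrite inE => /predU1P[->|]; last exact: He1.
  by rewrite !horner0.
have py_gt0 : 0 < `|p.[y]| by rewrite normr_gt0 ny ?mem_head.
have [e2 e2_gt0 He2] := poly_cont y p py_gt0.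
exists (Num.min e1 e2) => [|x q]; first by rewrite lt_min e1_gt0.
rewrite lt_min inE => /andP[xe1 xe2] /predU1P[->|]; last exact: He1.
have := He2 _ xe2; rewrite ltr_norml.
have [py|py|py] := ltgtP p.[y] 0.
- by rewrite (ltr0_norm py) opprK => /andP[_ h]; rewrite !ltr0_sg //; lra.
- by rewrite (gtr0_norm py) => /andP[h _]; rewrite !gtr0_sg //; lra.
- by move: py_gt0; rewrite py normr0 ltxx.
Qed.

Section RationalFunctions.

Variable R : realType.

(* The fraction [f.1 / f.2]. *)
Definition ratfun : Type := ({poly R} * {poly R})%type.

Implicit Types f g : ratfun.

Definition rf_eval f (x : R) : R := f.1.[x] / f.2.[x].

Definition rf_arith (op : arith) f g : ratfun :=
  match op with
  | Defs.Add => (f.1 * g.2 + g.1 * f.2, f.2 * g.2)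
  | Defs.Sub => (f.1 * g.2 - g.1 * f.2, f.2 * g.2)
  | Defs.Mul => (f.1 * g.1, f.2 * g.2)
  | Defs.Div => (f.1 * g.2, f.2 * g.1)
  end.

Lemma rf_arith_eval op f g (x v : R) : f.2.[x] != 0 -> g.2.[x] != 0 ->
    arith_eval op (rf_eval f x) (rf_eval g x) = Some v ->
  (rf_arith op f g).2.[x] != 0 /\ v = rf_eval (rf_arith op f g) x.
Proof.
move=> nzf nzg; have nzfg : f.2.[x] * g.2.[x] != 0 by rewrite mulf_neq0.
rewrite /rf_eval; case: op => /=; rewrite ?hornerD ?hornerN !hornerM.
- by case=> <-; split=> //; field; rewrite ?nzf ?nzg.
- by case=> <-; split=> //; field; rewrite ?nzf ?nzg.
- by case=> <-; split=> //; field; rewrite ?nzf ?nzg.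
rewrite mulf_eq0 invr_eq0 (negPf nzg) orbF; case: eqVneq => // nzg1 [<-].
by rewrite mulf_neq0 //; split=> //; field; rewrite nzg1 nzg nzf.
Qed.

Variable cs : seq R.

(** A finite list containing every function of the input that a cell can hold after [n] steps,
    whatever path is taken: ['X] is the input cell, 0 the blank cells, and [cs] the parameters. *)
Fixpoint reachable (n : nat) : seq ratfun :=
  if n is k.+1 then
    let S := reachable k in
    S ++ flatten [seq [seq rf_arith op f g | f <- S, g <- S]
                 | op <- [:: Defs.Add; Defs.Sub; Defs.Mul; Defs.Div]]
  else ('X, 1) :: (0, 1) :: [seq (c%:P, 1) | c <- cs].

Lemma reachable_arith n op f g : f \in reachable n -> g \in reachable n ->
  rf_arith op f g \in reachable n.+1.
Proof.
move=> Sf Sg /=; rewrite !mem_cat.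
by case: op; rewrite (allpairs_f (rf_arith _) Sf Sg) ?orbT.
Qed.

Lemma reachable_mono m n : (m <= n)%N -> {subset reachable m <= reachable n}.
Proof.
move=> /subnKC <-; elim: (n - m)%N => [|k IHk] f Sf; first by rewrite addn0.
by rewrite addnS /= mem_cat IHk.
Qed.

Lemma reachableX n : ('X, 1) \in reachable n.
Proof. by apply: (reachable_mono (leq0n n)); rewrite mem_head. Qed.

Lemma reachable0 n : (0, 1) \in reachable n.
Proof. by apply: (reachable_mono (leq0n n)); rewrite !inE eqxx orbT. Qed.

Lemma reachable_const n c : c \in cs -> (c%:P, 1) \in reachable n.
Proof.
move=> cs_c; apply: (reachable_mono (leq0n n)); rewrite !inE; apply/orP; right.
by apply/orP; right; apply: map_f.
Qed.

(** These are the consequences of transcendence over the parameters that the argument relies on.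
    They exclude only countably many points. *)
Definition generic (y : R) : Prop := forall n f, f \in reachable n ->
  [/\ f.1 != 0 -> f.1.[y] != 0, f.2 != 0 -> f.2.[y] != 0 &
      f.2 != 0 -> ~ constant_ratio f.1 f.2 ->
      forall g : {poly rat}, g != 0 -> ~~ root (pQto g) (rf_eval f y)].

Lemma generic_exists : exists y, generic y.
Proof.
(* Where the denominator is nonzero, the roots of [f.1 - b *: f.2] are the points at which the
   fraction takes the algebraic value [b]. *)
pose B (ng : nat * {poly rat}) := flatten [seq rootsR f.1 ++ rootsR f.2 ++
  flatten [seq rootsR (f.1 - b *: f.2) | b <- rootsR (pQto ng.2)]
  | f <- reachable ng.1].
have [y Hy] := exists_notin_countable B; exists y => n f Sf.
have {}Hy (g : {poly rat}) : [&& y \notin rootsR f.1, y \notin rootsR f.2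
  & y \notin flatten [seq rootsR (f.1 - b *: f.2) | b <- rootsR (pQto g)]].
  by rewrite -!negb_or -!mem_cat; apply: contra (Hy (n, g)) => h;
    apply/flatten_mapP; exists f.
have /and3P[y1 y2 _] := Hy 0; split=> [nz1|nz2|nz2 nconst g nz_g].
- by rewrite -rootE -mem_rootsR.
- by rewrite -rootE -mem_rootsR.
have nz2y : f.2.[y] != 0 by rewrite -rootE -mem_rootsR.
have /and3P[_ _ y3] := Hy g; apply: contra y3 => g0; apply/flatten_mapP.
exists (rf_eval f y); first by rewrite mem_rootsR // map_poly_eq0.
rewrite mem_rootsR; first by rewrite /root !hornerE divfK ?subrr.
by apply: contra_not_neq nconst => /eqP; rewrite subr_eq0 => /eqP ?;
  exists (rf_eval f y).
Qed.

End RationalFunctions.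

(** * Simulation of a run *)

Section Simulation.

Variables (R : realType) (M : program R).

Definition parameters : seq R :=
  pmap (fun i => if i is Const _ c then Some c else None) M.

Lemma mem_parameters n k c : onth M n = Some (Const k c) -> c \in parameters.
Proof.
rewrite /parameters; elim: M n => [|i M' IHM] [|n] //=.
  by case=> ->; rewrite mem_head.
by move/IHM; case: i => //= *; rewrite inE; apply/orP; right.
Qed.

Variables (A0 : set R) (y x : R) (T : nat).

Let S := reachable parameters.

Hypothesis sgr_xy : forall f, f \in S T ->
  Num.sg f.1.[x] = Num.sg f.1.[y] /\ Num.sg f.2.[x] = Num.sg f.2.[y].
Hypothesis oracle_xy : forall f, f \in S T -> f.2.[y] != 0 ->
  A0 (rf_eval f y) <-> A0 (rf_eval f x).

(** A single function [f] accounts for a cell in both runs, so that [sgr_xy] and [oracle_xy] apply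
    to every test. The denominator at [x] is nonzero by [sgr_xy]. *)
Definition simulates (t : nat) (sy sx : config R) : Prop :=
  [/\ pc sy = pc sx, idx sy = idx sx &
      forall k, exists f, [/\ f \in S t, f.2.[y] != 0,
        cells sy k = rf_eval f y & cells sx k = rf_eval f x]].

Let sgr_den f : f \in S T -> (f.2.[x] == 0) = (f.2.[y] == 0).
Proof. by move=> /sgr_xy[_ E]; rewrite -sgr_eq0 E sgr_eq0. Qed.

Let sgr_eval f : f \in S T -> Num.sg (rf_eval f x) = Num.sg (rf_eval f y).
Proof. by move=> /sgr_xy[E1 E2]; rewrite /rf_eval !sgrM !sgrV E1 E2. Qed.

Lemma simulates_put t sy sx l f : simulates t sy sx ->
    f \in S t.+1 -> f.2.[y] != 0 ->
  simulates t.+1 (put sy l (rf_eval f y)) (put sx l (rf_eval f x)).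
Proof.
case=> Epc Eidx Ecells Sf nzf; split=> /=; rewrite ?Epc ?Eidx // => k.
have -> : addr sx l = addr sy l by case: l => //= r; rewrite Eidx.
case: eqP => _; first by exists f.
have [g [Sg nzg cy cx]] := Ecells k; exists g; split=> //.
exact: (reachable_mono (leqnSn t)).
Qed.

Lemma simulates_get t sy sx l : simulates t sy sx -> exists f,
  [/\ f \in S t, f.2.[y] != 0,
    Defs.get sy l = rf_eval f y & Defs.get sx l = rf_eval f x].
Proof.
case=> _ Eidx Ecells; rewrite /Defs.get.
have -> : addr sx l = addr sy l by case: l => //= r; rewrite Eidx.
exact: Ecells.
Qed.

Lemma simulates_cells t u sy sx pcv idxv : simulates t sy sx -> (t <= u)%N ->
  simulates u (Config pcv idxv (cells sy)) (Config pcv idxv (cells sx)).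
Proof.
case=> _ _ Ecells le_tu; split=> //= k.
have [f [Sf nzf cy cx]] := Ecells k; exists f; split=> //.
exact: (reachable_mono le_tu).
Qed.

(** Tuples of length other than one are rejected in both runs; length one is [oracle_xy]. *)
Lemma simulates_query t sy sx a n : (t <= T)%N -> simulates t sy sx ->
  (block sy a n \in tuples1 A0) = (block sx a n \in tuples1 A0).
Proof.
move=> le_tT [_ _ Ecells].
case: n => [|[|n]]; rewrite /block /=; try by
  apply/idP/idP; rewrite !inE => -[].
have [f [Sf nzf -> ->]] := Ecells a.
have [yx xy] := oracle_xy (reachable_mono le_tT Sf) nzf.
apply/idP/idP; rewrite !inE => -[z A0z [Dz]].
  by exists (rf_eval f x) => //; apply: yx; rewrite -Dz.
by exists (rf_eval f y) => //; apply: xy; rewrite -Dz.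
Qed.

Lemma simulates_step t sy sx sy' : (t < T)%N -> simulates t sy sx ->
    step M (tuples1 A0) sy = Some sy' ->
  exists2 sx', step M (tuples1 A0) sx = Some sx' & simulates t.+1 sy' sx'.
Proof.
move=> lt_tT sim; have [Epc Eidx _] := sim; rewrite /step -Epc.
case Di : (onth M (pc sy)) =>
  [[k c|op k i j|k i|k|i ln lz lp|r|r|r lz lp|p q lyes lno|]|] //=.
- case=> <-; exists (put sx k c) => //.
  have := simulates_put k sim (reachable_const t.+1 (mem_parameters Di)).
  by rewrite /rf_eval /= !hornerC divr1; apply; rewrite oner_eq0.
- have [f [Sf nzf -> ->]] := simulates_get i sim.
  have [g [Sg nzg -> ->]] := simulates_get j sim.
  case Dv : arith_eval => [v|] //= [<-].
  have [nzh Dvy] := rf_arith_eval nzf nzg Dv.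
  have [ST1 ST2] := (reachable_mono (ltnW lt_tT) Sf,
    reachable_mono (ltnW lt_tT) Sg).
  have nzfx : f.2.[x] != 0 by rewrite sgr_den.
  have nzgx : g.2.[x] != 0 by rewrite sgr_den.
  (* A division that is legal at [y] is legal at [x], because the two divisors have the same
     sign. *)
  have [w Dw] : exists w, arith_eval op (rf_eval f x) (rf_eval g x) = Some w.
    case: op Dv {Di Dvy nzh} => /=; try by move=> *; eexists.
    by rewrite -sgr_eq0 -(sgr_eval ST2) sgr_eq0; case: eqP => // _ _; eexists.
  have [_ Dwx] := rf_arith_eval nzfx nzgx Dw.
  exists (put sx k w); first by rewrite Dw.
  by rewrite Dvy Dwx; apply: simulates_put => //; apply: reachable_arith.
- case=> <-; have [f [Sf nzf -> ->]] := simulates_get i sim.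
  exists (put sx k (rf_eval f x)) => //; apply: simulates_put => //.
  exact: (reachable_mono (leqnSn t)).
- case=> <-; exists (put sx k 0) => //.
  have := simulates_put k sim (reachable0 _ t.+1).
  by rewrite /rf_eval /= !hornerC divr1; apply; rewrite oner_eq0.
- case=> <-; have [f [Sf nzf -> ->]] := simulates_get i sim.
  have E := sgr_eval (reachable_mono (ltnW lt_tT) Sf).
  rewrite -[rf_eval f y < 0]sgr_lt0 -E sgr_lt0 -[rf_eval f y == 0]sgr_eq0 -E
    sgr_eq0.
  eexists; first by [].
  by rewrite /jump Eidx; apply: simulates_cells sim _.
- by case=> <-; eexists; first by []; rewrite /put_idx Eidx Epc;
  apply: simulates_cells sim _.
- by case=> <-; eexists; first by []; rewrite /put_idx Eidx Epc;
  apply: simulates_cells sim _.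
- by case=> <-; eexists; first by []; rewrite /jump Eidx;
  apply: simulates_cells sim _.
- case=> <-; rewrite (simulates_query _ _ (ltnW lt_tT) sim).
  by eexists; first by []; rewrite /jump Eidx; apply: simulates_cells sim _.
Qed.

Lemma simulates_run t sy : (t <= T)%N ->
  run M (tuples1 A0) [:: y] t = Some sy ->
  exists2 sx, run M (tuples1 A0) [:: x] t = Some sx & simulates t sy sx.
Proof.
elim: t sy => [|t IHt] sy; rewrite /run /=.
  move=> _ [<-]; eexists; first by []; split=> //= -[|k]; rewrite /= ?nth_nil.
    exists ('X, 1); rewrite /rf_eval /= !hornerX !hornerC oner_eq0 !divr1.
    by split=> //; apply: (reachableX _ 0).
  exists (0, 1); rewrite /rf_eval /= !hornerC oner_eq0 !divr1 ?nth_nil.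
  by split=> //; apply: (reachable0 _ 0).
rewrite -/(run M (tuples1 A0) [:: y] t) -/(run M (tuples1 A0) [:: x] t) =>
  lt_tT.
case Ds: run => [s|] //= step_s.
have [sx -> sim] := IHt _ (ltnW lt_tT) Ds.
by have [sx' step_sx sim'] := simulates_step lt_tT sim step_s; exists sx'.
Qed.

End Simulation.

(** After [Halt] there is no next configuration, so a run meets [Halt] at most once. *)
Lemma run_halt_unique (R : realType) (M : program R) (A :
  set (seq R)) x t t' s s' :
    run M A x t = Some s -> onth M (pc s) = Some Halt ->
    run M A x t' = Some s' -> onth M (pc s') = Some Halt ->
  s = s'.
Proof.
wlog le_tt' : t t' s s' / (t <= t')%N => [hw|] Ds Hs Ds' Hs'.
  by case/orP: (leq_total t t') => le; [|apply: esym]; apply: (hw _ _ _ _ le).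
have run_None k : run M A x (t + k.+1)%N = None.
  elim: k => [|k IHk]; last by rewrite addnS /run /= -/(run M A x _) IHk.
  by rewrite addn1 /run /= -/(run M A x _) Ds /= /step Hs.
move: le_tt' Ds' => /subnKC <-; case: (t' - t)%N => [|k].
  by rewrite addn0 Ds => -[].
by rewrite run_None.
Qed.

(** Allowing any [B] between the numbers of degree exactly [d] and those of degree at most [d]
    treats both claims at once. *)
Lemma not_bss_reducible_alg (R : realType) (d : nat) (B : set R) : (0 < d)%N ->
    (forall x, alg_eq R d x -> B x) -> (forall x, B x -> alg_le R d x) ->
  ~ bss_reducible (tuples1 B) (tuples1 (alg_le R d.-1)).
Proof.
move=> d_gt0 eqB Ble [M HM].
have [m [irr_m sz_m [a ma]]] := irreducible_real_root R d_gt0.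
pose S := reachable (parameters M).
have [y gen_y] := generic_exists (parameters M).
have [T [sy [run_y halt_y out_y]]] := HM [:: y].
have nonalg n f : f \in S T -> f.2 != 0 -> ~ constant_ratio f.1 f.2 ->
    ~ alg_le R n (rf_eval f y).
  move=> Sf nzf nconst /alg_leP[g [nz_g g0 _]].
  by have [_ _ /(_ nzf nconst g nz_g)/negP[]] := gen_y _ _ Sf.
have [e e_gt0 He] : exists2 e, 0 < e & forall x p, `|x - y| < e ->
    p \in flatten [seq [:: f.1; f.2] | f <- S T] -> Num.sg p.[x] = Num.sg p.[y].
  apply: sgr_horner_near => p /flatten_mapP[f Sf];
    have [n1 n2 _] := gen_y _ _ Sf.
  by rewrite !inE => /orP[] /eqP->.
have good : almost_all (fun r => almost_all (fun q => forall f, f \in S T ->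
    let x := ratr q + ratr r * a in f.2 != 0 -> ~ constant_ratio f.1 f.2 ->
    f.2.[x] != 0 -> ~ alg_le R d.-1 (rf_eval f x))).
  have : almost_all (fun r => forall f, f \in S T -> almost_all (fun q =>
      let x := ratr q + ratr r * a in f.2 != 0 -> ~ constant_ratio f.1 f.2 ->
      f.2.[x] != 0 -> ~ alg_le R d.-1 (rf_eval f x))).
    apply: almost_all_seq => f Sf.
    have [nzf|zf] := boolP (f.2 != 0); last first.
      by exists [::] => r _; exists [::] => q _ x nzf; case/negP: zf.
    have [cst|nconst] := pselect (constant_ratio f.1 f.2).
      by exists [::] => r _; exists [::] => q _ x _ [].
    apply: almost_allS (ratio_degree irr_m ma nzf nconst) => r.
    apply: almost_allS => q H x _ _ nzx /alg_leP[g [nz_g g0 sz_g]].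
    have lt_gm : (size g < size m)%N by rewrite sz_m -(prednK d_gt0) ltnS.
    by case/negP: (H nzx g nz_g lt_gm).
  by apply: almost_allS => r H; apply: almost_all_seq.
have good0 : almost_all (fun r => r != 0) by exists [:: 0] => r; rewrite inE.
(* Any good nonzero [r] will do. It is fixed first, and then [q] is taken close to [y - r a] to
   bring [x] within [e] of [y]. *)
have [r [good_r nz_r] _] := almost_all_itv (almost_allI good good0) (@ltr01 R).
have [|q good_q] := @almost_all_itv R _ (y - ratr r * a - e) (y - ratr r * a +
  e) good_r.
  lra.
set x := ratr q + ratr r * a => near_x.
have {near_x} xy : `|x - y| < e by rewrite ltr_norml /x; apply/andP; split; lra.
have Bx : B x.
  by apply: eqB; have := alg_eq_affine q irr_m ma nz_r; rewrite sz_m.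
have sgr_xy f : f \in S T ->
    Num.sg f.1.[x] = Num.sg f.1.[y] /\ Num.sg f.2.[x] = Num.sg f.2.[y].
  by move=> Sf; split; apply: He => //; apply/flatten_mapP; exists f => //;
    rewrite !inE eqxx ?orbT.
have oracle_xy f : f \in S T -> f.2.[y] != 0 ->
    alg_le R d.-1 (rf_eval f y) <-> alg_le R d.-1 (rf_eval f x).
  move=> Sf nzfy.
  have nzfx : f.2.[x] != 0.
    by have [_ E] := sgr_xy f Sf; rewrite -sgr_eq0 E sgr_eq0.
  have nzf : f.2 != 0 by apply: contraNneq nzfy => ->; rewrite horner0.
  (* A constant function asks the same question in both runs; a nonconstant one gets a negative
     answer in both. *)
  have [[c cst]|nconst] := pselect (constant_ratio f.1 f.2).
    by rewrite /rf_eval cst !hornerZ !mulfK.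
  by split=> [/(nonalg _ _ Sf nzf nconst)|/(good_q _ Sf nzf nconst nzfx)].
have [sx run_x [Epc Eidx Ecells]] :=
  simulates_run sgr_xy oracle_xy (leqnn T) run_y.
have [t [s [run_s halt_s out_x]]] := HM [:: x].
have Ds : sx = s by apply: run_halt_unique run_x _ run_s halt_s; rewrite -Epc.
(* The identity is a nonconstant reachable function, so the generic [y] is not algebraic. *)
have nBy : ~ B y.
  move/Ble; have -> : y = rf_eval ('X,
    1) y by rewrite /rf_eval /= hornerX hornerC divr1.
  apply: nonalg; rewrite ?reachableX ?oner_eq0 //= => -[c].
  move/(congr1 (fun p : {poly R} => p`_1)); rewrite coefZ coefX coef1 mulr0.
  by move/eqP; rewrite oner_eq0.
have out1 (u : config R) v : output u = [:: v] -> idx u 0 = 1%N /\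
  cells u 0 = v.
  by rewrite /output /block; case: (idx u 0) => [|[|n]] //= [->] //.
have [_ cell_y] := out1 _ _ out_y; have [_] := out1 _ _ out_x.
have [f [Sf nzf cy cx]] := Ecells 0%N; rewrite -Ds cx !indicE.
have -> : [:: x] \in tuples1 B by rewrite inE; exists x.
(* The output cell holds 0 on [y], hence also on [x] by equality of signs, whereas [B x] requires
   1. *)
suff -> : rf_eval f x = 0 by move/eqP; rewrite eq_sym oner_eq0.
have : rf_eval f y = 0.
  rewrite -cy cell_y indicE; case: (boolP (_ \in _)) => //.
  by rewrite inE => -[z Bz [zy]]; case: nBy; rewrite -zy.
have [E1 E2] := sgr_xy f Sf.
have E : Num.sg (rf_eval f x) = Num.sg (rf_eval f y).
  by rewrite /rf_eval !sgrM !sgrV E1 E2.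
by move/eqP; rewrite -sgr_eq0 -E sgr_eq0 => /eqP.
Qed.

Theorem theorem4p1 (R : realType) (d : nat) (hd : (0 < d)%N) :
  ~ bss_reducible (tuples1 (alg_le R d)) (tuples1 (alg_le R d.-1)) /\
  ~ bss_reducible (tuples1 (alg_eq R d)) (tuples1 (alg_le R d.-1)).
Proof.
have eq_le x : alg_eq R d x -> alg_le R d x by move=> Hx; exists d => /=.
by split; apply: not_bss_reducible_alg.
Qed.
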